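(* Let $\mathbb{K}=\mathbb{F}_q$ be a finite field and let $X$ be a complete simplicial toric variety over $\mathbb{K}$ with torsion-free class group $\operatorname{Cl}(X)\cong\mathbb{Z}^d$, total coordinate ring $S=\mathbb{K}[x_1,\dots,x_r]$ and degree matrix $\beta$. Let $Q\in M_{s\times r}(\mathbb{Z})$ be homogeneous, i.e. there is a matrix $A\in M_{d\times s}(\mathbb{Q})$ with $AQ=\beta$. Put $L_Q=\ker_{\mathbb{Z}}Q$, $L_\beta=\ker_{\mathbb{Z}}\beta$, $L=L_Q+(q-1)L_\beta$, $\mathcal{L}=QL_\beta=\{Q\mathbf{m} : \mathbf{m}\in L_\beta\}\subseteq\mathbb{Z}^s$ and $\mathcal{L}:(q-1)=\{\mathbf{m}\in\mathbb{Z}^s : (q-1)\mathbf{m}\in\mathcal{L}\}$. Let $Y_Q\subseteq T_X$ be the toric set parameterized by $Q$ and let $V_Q:=V_X(I_{L_Q})\cap T_X$. Then: \begin{enumerate} \item $V_Q=V_X(I_L)$; \item if $\mathcal{L}=\mathcal{L}:(q-1)$, then $V_Q=Y_Q$; \item if $\mathcal{L}=\mathcal{L}:(q-1)$, then $I(V_X(I_L))=I_L$. \end{enumerate}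
   Context: Setting. $X$ is given by a fan $\Sigma$ in $\mathbb{R}^n$ with $r$ rays, whose primitive generators $\mathbf{v}_1,\dots,\mathbf{v}_r\in\mathbb{Z}^n$ span $\mathbb{R}^n$; $d=r-n$. Let $\phi:\mathbb{Z}^n\to\mathbb{Z}^r$ be the linear map given by the $r\times n$ matrix with rows $\mathbf{v}_1,\dots,\mathbf{v}_r$, and let $\beta:\mathbb{Z}^r\to\mathbb{Z}^d$ be a linear map (identified with a $d\times r$ integer matrix with columns $\beta_j=\beta(e_j)$) such that $0\to\mathbb{Z}^n\xrightarrow{\phi}\mathbb{Z}^r\xrightarrow{\beta}\mathbb{Z}^d\to 0$ is exact (so $\operatorname{Cl}(X)\cong\mathbb{Z}^d$). The ring $S$ is $\mathbb{Z}^d$-graded by $\deg(x_j)=\beta_j$. For $\mathbf{a}\in\mathbb{Z}^k$ and $\mathbf{t}=(t_1,\dots,t_k)$ write $\mathbf{t}^{\mathbf{a}}=t_1^{a_1}\cdots t_k^{a_k}$. Let $\mathbf{u}_1,\dots,\mathbf{u}_n$ be the columns of $\phi$, let $\pi:(\mathbb{K}^* )^r\to(\mathbb{K}^* )^n$, $\pi(\mathbf{t})=(\mathbf{t}^{\mathbf{u}_1},\dots,\mathbf{t}^{\mathbf{u}_n})$, and $G=\ker\pi$. Points of $X$ are described over $\mathbb{K}$ by homogeneous (Cox) coordinates: they are the orbits $[P]=G\cdot P$ of points $P\in\mathbb{K}^r\setminus V(B)$, where $B\subseteq S$ is the irrelevant ideal generated by the monomials $\prod_{\rho_i\not\subset\sigma}x_i$,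 $\sigma\in\Sigma$ ($\rho_i$ being the ray generated by $\mathbf{v}_i$). The torus of $X$ is $T_X=(\mathbb{K}^* )^r/G\subseteq X$, with elements $[p_1:\cdots:p_r]:=G\cdot(p_1,\dots,p_r)$. For $Q=[\mathbf{q}_1\cdots\mathbf{q}_r]\in M_{s\times r}(\mathbb{Z})$ (columns $\mathbf{q}_i\in\mathbb{Z}^s$), the toric set parameterized by $Q$ is $Y_Q=\{[\mathbf{t}^{\mathbf{q}_1}:\cdots:\mathbf{t}^{\mathbf{q}_r}] : \mathbf{t}\in(\mathbb{K}^* )^s\}\subseteq T_X$. The vanishing ideal $I(Y)\subseteq S$ of a subset $Y\subseteq X$ is the ideal generated by all homogeneous polynomials of $S$ (for the $\mathbb{Z}^d$-grading) that vanish at all points of $Y$. For a homogeneous ideal $J\subseteq S$, its zero locus in $X$ is $V_X(J)=\{[P]\in X : F(P)=0\text{ for all homogeneous }F\in J\}$. A lattice is a subgroup $L\subseteq\mathbb{Z}^r$; its lattice ideal $I_L\subseteq S$ is the ideal generated by all binomials $\mathbf{x}^{\mathbf{a}}-\mathbf{x}^{\mathbf{b}}$ with $\mathbf{a},\mathbf{b}\in\mathbb{N}^r$ and $\mathbf{a}-\mathbf{b}\in L$ (where $\mathbb{N}$ is the set of non-negative integers). For an integer matrix $M$ with $r$ columns, $\ker_{\mathbb{Z}}M=\{\mathbf{m}\in\mathbb{Z}^r : M\mathbf{m}=0\}$. When $Q$ is homogeneous, the ideals $I_{L_Q}$ and $I_L$ are homogeneous for the $\mathbb{Z}^d$-grading.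 *)

(* Defs.v *)
From mathcomp Require Import all_boot all_order all_algebra.
From mathcomp Require Import boolp classical_sets cardinality reals.
From mathcomp Require Import mpoly.

Set Implicit Arguments.
Unset Strict Implicit.
Unset Printing Implicit Defensive.

Import GRing.Theory Num.Theory.
Local Open Scope classical_set_scope.
Local Open Scope ring_scope.

(* Vectors of R^n, of the lattice Z^n and of K^r are rows; exponent vectors
   and degrees are columns. *)

Definition cone (R : realType) (n : nat) (S : seq 'rV[int]_n) : set 'rV[R]_n :=
  [set x | exists2 c : 'I_(size S) -> R, (forall i, 0 <= c i) &
     x = \sum_i c i *: map_mx intr S`_i].
Arguments cone R {n} S.

Definition rational_polyhedral (R : realType) (n : nat) (sigma : set 'rV[R]_n) :=
  exists S : seq 'rV[int]_n, sigma = cone R S.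

Definition strongly_convex (R : realType) (n : nat) (sigma : set 'rV[R]_n) :=
  forall x, sigma x -> sigma (- x) -> x = 0.

Definition dot (R : realType) (n : nat) (m x : 'rV[R]_n) : R :=
  \sum_j m 0 j * x 0 j.

Definition is_face (R : realType) (n : nat) (tau sigma : set 'rV[R]_n) :=
  exists2 m : 'rV[R]_n, (forall x, sigma x -> 0 <= dot m x) &
    tau = sigma `&` [set x | dot m x = 0].

Definition is_fan (R : realType) (n : nat) (Sigma : set (set 'rV[R]_n)) :=
  [/\ finite_set Sigma,
      forall sigma, Sigma sigma ->
        rational_polyhedral sigma /\ strongly_convex sigma,
      forall sigma tau, Sigma sigma -> is_face tau sigma -> Sigma tau &
      forall sigma tau, Sigma sigma -> Sigma tau ->
        is_face (sigma `&` tau) sigma /\ is_face (sigma `&` tau) tau].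

Definition complete_fan (R : realType) (n : nat) (Sigma : set (set 'rV[R]_n)) :=
  forall x, exists2 sigma, Sigma sigma & sigma x.

(* The zero vector is not primitive, since 0 = 0 *: 0. *)
Definition primitive_vec (n : nat) (v : 'rV[int]_n) :=
  forall (k : int) (w : 'rV[int]_n), v = k *: w -> `|k| = 1.

Definition ray (R : realType) (n r : nat) (phi : 'M[int]_(r, n)) (i : 'I_r) :
  set 'rV[R]_n := cone R [:: row i phi].
Arguments ray R {n r} phi i.

(* The rows of phi enumerate, without repetition, the primitive generators of
   the rays of Sigma: every one-dimensional strongly convex rational cone is
   cone [:: u] for a unique primitive u. *)
Definition ray_generators (R : realType) (n r : nat)
    (Sigma : set (set 'rV[R]_n)) (phi : 'M[int]_(r, n)) :=
  [/\ forall i, primitive_vec (row i phi),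
      injective (fun i => row i phi),
      forall i, Sigma (ray R phi i) &
      forall u, primitive_vec u -> Sigma (cone R [:: u]) ->
        exists i, u = row i phi].

(* The minimal generators of a cone of the fan are the primitive generators of
   the rays contained in it; they must be linearly independent over R. *)
Definition simplicial_fan (R : realType) (n r : nat)
    (Sigma : set (set 'rV[R]_n)) (phi : 'M[int]_(r, n)) :=
  forall sigma, Sigma sigma -> forall c : 'I_r -> R,
    (forall i, ~ (ray R phi i `<=` sigma) -> c i = 0) ->
    \sum_i c i *: map_mx intr (row i phi) = 0 :> 'rV[R]_n ->
    forall i, c i = 0.

Definition short_exact (n r d : nat)
    (phi : 'M[int]_(r, n)) (beta : 'M[int]_(d, r)) :=
  [/\ injective (fun m : 'cV[int]_n => phi *m m),
      forall x : 'cV[int]_r, beta *m x = 0 <-> exists m, x = phi *m m &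
      forall y : 'cV[int]_d, exists x : 'cV[int]_r, y = beta *m x].

Definition ideal_gen (K : fieldType) (r : nat) (E : set {mpoly K[r]}) :
  set {mpoly K[r]} :=
  [set F | exists2 s : seq ({mpoly K[r]} * {mpoly K[r]}),
     (forall p, p \in s -> E p.2) & F = \sum_(p <- s) p.1 * p.2].
Arguments ideal_gen {K r} E.

Definition expvec (r : nat) (m : 'X_{1..r}) : 'cV[int]_r :=
  \col_j (m j)%:Z.

(* deg x_j is the j-th column of beta. *)
Definition homogeneous (K : fieldType) (r d : nat) (beta : 'M[int]_(d, r))
    (F : {mpoly K[r]}) :=
  exists delta : 'cV[int]_d,
    forall m, m \in msupp F -> beta *m expvec m = delta.

Definition lattice_ideal (K : fieldType) (r : nat) (L : set 'cV[int]_r) :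
  set {mpoly K[r]} :=
  ideal_gen [set F | exists a b : 'X_{1..r},
    L (expvec a - expvec b) /\ F = 'X_[a] - 'X_[b]].
Arguments lattice_ideal K {r} L.

Definition irrelevant_ideal (R : realType) (K : fieldType) (n r : nat)
    (Sigma : set (set 'rV[R]_n)) (phi : 'M[int]_(r, n)) : set {mpoly K[r]} :=
  ideal_gen [set \prod_(i < r | `[< ~ (ray R phi i `<=` sigma) >]) 'X_i
            | sigma in Sigma].
Arguments irrelevant_ideal {R} K {n r} Sigma phi.

Definition affine_zeros (K : fieldType) (r : nat) (J : set {mpoly K[r]}) :
  set 'rV[K]_r :=
  [set P | forall F, J F -> F.@[P 0] = 0].
Arguments affine_zeros {K r} J.

(* A K-point of X is the orbit of its Cox coordinates under Cox_group, i.e. a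
   subset of K^r; a subset of X is therefore a set of subsets of K^r. *)

Definition torus (K : fieldType) (k : nat) : set 'rV[K]_k :=
  [set t | forall i, t 0 i != 0].
Arguments torus K k : clear implicits.

Definition laurent_monom (K : fieldType) (k : nat) (t : 'rV[K]_k)
    (a : 'cV[int]_k) : K :=
  \prod_i t 0 i ^ a i 0.

Definition monom_map (K : fieldType) (k l : nat) (M : 'M[int]_(k, l))
    (t : 'rV[K]_k) : 'rV[K]_l :=
  \row_j laurent_monom t (col j M).
Arguments monom_map {K k l} M t.

Definition Cox_group (K : fieldType) (n r : nat) (phi : 'M[int]_(r, n)) :
  set 'rV[K]_r :=
  [set g | torus K r g /\ monom_map phi g = const_mx 1].
Arguments Cox_group K {n r} phi.

Definition Cox_point (K : fieldType) (n r : nat) (phi : 'M[int]_(r, n))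
    (P : 'rV[K]_r) : set 'rV[K]_r :=
  [set \row_i (g 0 i * P 0 i) | g in Cox_group K phi].
Arguments Cox_point {K n r} phi P.

Definition torus_X (K : fieldType) (n r : nat) (phi : 'M[int]_(r, n)) :
  set (set 'rV[K]_r) :=
  [set Cox_point phi P | P in torus K r].
Arguments torus_X K {n r} phi.

Definition toric_set (K : fieldType) (n r s : nat) (phi : 'M[int]_(r, n))
    (Q : 'M[int]_(s, r)) : set (set 'rV[K]_r) :=
  [set Cox_point phi (monom_map Q t) | t in torus K s].
Arguments toric_set K {n r s} phi Q.

Definition zero_locus (R : realType) (K : fieldType) (n r d : nat)
    (Sigma : set (set 'rV[R]_n)) (phi : 'M[int]_(r, n)) (beta : 'M[int]_(d, r))
    (J : set {mpoly K[r]}) : set (set 'rV[K]_r) :=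
  [set Cox_point phi P | P in
     [set P | ~ affine_zeros (irrelevant_ideal K Sigma phi) P /\
              forall F, J F -> homogeneous beta F -> F.@[P 0] = 0]].
Arguments zero_locus {R K n r d} Sigma phi beta J.

Definition vanishing_ideal (K : fieldType) (n r d : nat)
    (phi : 'M[int]_(r, n)) (beta : 'M[int]_(d, r))
    (Y : set (set 'rV[K]_r)) : set {mpoly K[r]} :=
  ideal_gen [set F | homogeneous beta F /\
    forall P, Y (Cox_point phi P) -> F.@[P 0] = 0].
Arguments vanishing_ideal {K n r d} phi beta Y.

Definition int_ker (r k : nat) (M : 'M[int]_(k, r)) : set 'cV[int]_r :=
  [set m | M *m m = 0].
Arguments int_ker {r k} M.

Definition lattice_add (r : nat) (L1 L2 : set 'cV[int]_r) : set 'cV[int]_r :=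
  [set x | exists m1 m2, [/\ L1 m1, L2 m2 & x = m1 + m2]].

Definition lattice_scale (r : nat) (k : int) (L : set 'cV[int]_r) :
  set 'cV[int]_r := [set k *: m | m in L].

Definition lattice_colon (r : nat) (L : set 'cV[int]_r) (k : int) :
  set 'cV[int]_r := [set m | L (k *: m)].

Definition homogeneous_matrix (r d s : nat) (beta : 'M[int]_(d, r))
    (Q : 'M[int]_(s, r)) :=
  exists A : 'M[rat]_(d, s), A *m map_mx intr Q = map_mx intr beta.

(* Main.v *)
(** On the torus a point satisfies the binomials of a lattice iff its Laurent
    monomials at the lattice vectors equal 1; since (q-1)-st powers are 1 on the
    torus, [L_Q] and [L] impose the same conditions there.  The zero locus of
    [I_L] is contained in the torus: the vanishing coordinates of a point
    outside the irrelevant locus belong to rays of one simplicial cone, so some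
    m in Z^n is positive on all of them, and the binomial of (q-1) phi m in [L]
    cannot vanish at the point.

    Through discrete logarithms, parameterizing such a torus point amounts to
    solving a linear system modulo q-1; by the Smith normal form of [Q phi] the
    condition [calL = calL : (q-1)] says that its nonzero elementary divisors
    are prime to q-1, which makes the system solvable.

    For the ideal, orthogonality of the characters of the torus shows that in a
    homogeneous polynomial vanishing on [Y_Q] the coefficients of the monomials
    restricting to a given character add up to zero; by saturation, such
    monomials of equal degree are congruent modulo [L]. *)

Require Import Defs.
From mathcomp Require Import all_boot all_order all_algebra.
From mathcomp Require Import fingroup cyclic finfield.
From mathcomp Require Import boolp classical_sets cardinality reals.
From mathcomp Require Import mpoly.
From mathcomp Require Import zify ring.

Set Implicit Arguments.
Unset Strict Implicit.
Unset Printing Implicit Defensive.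

Import Order.TTheory GRing.Theory Num.Theory.
Local Open Scope classical_set_scope.
Local Open Scope ring_scope.

(** * Laurent monomials as characters of the torus *)

Section LaurentMonomials.

Variable K : fieldType.

Lemma expfz_sum (x : K) (I : finType) (e : I -> int) :
  x != 0 -> x ^ (\sum_i e i) = \prod_i x ^ e i.
Proof.
move=> x0; elim/big_rec2: _ => [|i y z _ <-]; first by rewrite expr0z.
by rewrite expfzDr.
Qed.

Lemma laurent_monomD (k : nat) (t : 'rV[K]_k) (a b : 'cV[int]_k) :
  torus K k t ->
  laurent_monom t (a + b) = laurent_monom t a * laurent_monom t b.
Proof.
move=> tT; rewrite -big_split; apply: eq_bigr => i _ /=.
by rewrite mxE expfzDr.
Qed.

Lemma laurent_monom0 (k : nat) (t : 'rV[K]_k) : laurent_monom t 0 = 1.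
Proof. by apply: big1 => i _; rewrite mxE expr0z. Qed.

Lemma laurent_monom1 (k : nat) (a : 'cV[int]_k) :
  laurent_monom (const_mx 1 : 'rV[K]_k) a = 1.
Proof. by apply: big1 => i _; rewrite mxE exp1rz. Qed.

Lemma laurent_monom_neq0 (k : nat) (t : 'rV[K]_k) (a : 'cV[int]_k) :
  torus K k t -> laurent_monom t a != 0.
Proof.
move=> tT; rewrite /laurent_monom; apply/prodf_neq0 => i _.
exact: expfz_neq0.
Qed.

Lemma laurent_monomZ (k : nat) (t : 'rV[K]_k) (c : int) (a : 'cV[int]_k) :
  laurent_monom t (c *: a) = laurent_monom t a ^ c.
Proof.
rewrite /laurent_monom.
rewrite (big_morph (fun x : K => x ^ c)
  (fun x y => expfzMl x y c) (exp1rz _ c)).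
by apply: eq_bigr => i _; rewrite mxE mulrC exprz_exp.
Qed.

Lemma laurent_monomB (k : nat) (t : 'rV[K]_k) (a b : 'cV[int]_k) :
  torus K k t ->
  laurent_monom t (a - b) = laurent_monom t a / laurent_monom t b.
Proof.
by move=> tT; rewrite laurent_monomD// -[- b]scaleN1r laurent_monomZ exprN1.
Qed.

Lemma laurent_monomM (k : nat) (t u : 'rV[K]_k) (a : 'cV[int]_k) :
  laurent_monom (\row_i (t 0 i * u 0 i)) a =
  laurent_monom t a * laurent_monom u a.
Proof.
by rewrite -big_split; apply: eq_bigr => i _ /=; rewrite mxE expfzMl.
Qed.

Lemma monom_map_torus (k l : nat) (M : 'M[int]_(k, l)) (t : 'rV[K]_k) :
  torus K k t -> torus K l (monom_map M t).
Proof. by move=> tT j; rewrite mxE laurent_monom_neq0. Qed.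

Lemma laurent_monom_map (k l : nat) (M : 'M[int]_(k, l)) (t : 'rV[K]_k)
    (m : 'cV[int]_l) :
  torus K k t -> laurent_monom (monom_map M t) m = laurent_monom t (M *m m).
Proof.
move=> tT; rewrite /laurent_monom.
under eq_bigr => j _ do rewrite mxE -laurent_monomZ.
rewrite exchange_big /=; apply: eq_bigr => i _.
rewrite mxE expfz_sum//; apply: eq_bigr => j _.
by rewrite !mxE mulrC.
Qed.

Lemma meval_laurent (r : nat) (P : 'rV[K]_r) (a : 'X_{1..r}) :
  'X_[a].@[P 0] = laurent_monom P (expvec a).
Proof. by rewrite mevalX; apply: eq_bigr => i _; rewrite mxE. Qed.

End LaurentMonomials.

(** * Generated ideals and lattice ideals *)

Section Ideals.

Variables (K : fieldType) (r : nat).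

Lemma ideal_gen_sub (E E' : set {mpoly K[r]}) :
  E `<=` ideal_gen E' -> ideal_gen E `<=` ideal_gen E'.
Proof.
move=> EE' F [u uE ->] {F}; elim: u uE => [|p u IH] uE.
  by exists [::] => //; rewrite !big_nil.
have [v vE ev] := IH (fun p pu => uE p (mem_behead (s := _ :: u) pu)).
have [w wE ew] := EE' _ (uE p (mem_head _ _)).
exists ([seq (p.1 * x.1, x.2) | x <- w] ++ v).
  by move=> x; rewrite mem_cat => /orP[/mapP[y /wE yE' ->]|/vE].
rewrite big_cons big_cat ev ew big_map mulr_sumr /=; congr (_ + _).
by apply: eq_bigr => i _; rewrite mulrA.
Qed.

Lemma sub_ideal_gen (E : set {mpoly K[r]}) : E `<=` ideal_gen E.
Proof.
move=> F EF; exists [:: (1, F)]; last by rewrite big_seq1 mul1r.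
by move=> p; rewrite inE => /eqP ->.
Qed.

Lemma ideal_gen_mono (E E' : set {mpoly K[r]}) :
  E `<=` E' -> ideal_gen E `<=` ideal_gen E'.
Proof. by move=> EE'; apply: ideal_gen_sub => F /EE'; apply: sub_ideal_gen. Qed.

Lemma ideal_gen_zero (E : set {mpoly K[r]}) (P : 'rV[K]_r) :
  (forall F, E F -> F.@[P 0] = 0) -> forall F, ideal_gen E F -> F.@[P 0] = 0.
Proof.
move=> EP F [u uE ->]; rewrite raddf_sum /= big_seq; apply: big1 => p pu.
by rewrite mevalM (EP _ (uE _ pu)) mulr0.
Qed.

Lemma ideal_gen_sum (E : set {mpoly K[r]}) (I : eqType) (u : seq I)
    (c : I -> {mpoly K[r]}) (F : I -> {mpoly K[r]}) :
  (forall i, i \in u -> E (F i)) -> ideal_gen E (\sum_(i <- u) c i * F i).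
Proof.
move=> uE; exists [seq (c i, F i) | i <- u]; last by rewrite big_map.
by move=> p /mapP[i /uE ? ->].
Qed.

(** With [pos_part (- m)] as negative part, this turns a lattice vector into a binomial whose two
    monomials share no variable. *)
Definition pos_part (m : 'cV[int]_r) : 'X_{1..r} :=
  [multinom (if 0 <= m i 0 then absz (m i 0) else 0%N)%R | i < r].

Lemma pos_partB (m : 'cV[int]_r) :
  expvec (pos_part m) - expvec (pos_part (- m)) = m.
Proof.
apply/colP => i; rewrite !mxE !mnmE !mxE.
by move: (m i 0) => x; case: ifP; case: ifP; lia.
Qed.

Lemma homogeneous_binomial (d : nat) (beta : 'M[int]_(d, r)) (a b : 'X_{1..r}) :
  beta *m (expvec a - expvec b) = 0 ->
  homogeneous beta ('X_[a] - 'X_[b] : {mpoly K[r]}).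
Proof.
rewrite mulmxBr => /eqP; rewrite subr_eq0 => /eqP ab.
exists (beta *m expvec b) => m /msuppB_le; rewrite mem_cat !msuppX !inE.
by case/orP => /eqP ->.
Qed.

Definition annihilates (P : 'rV[K]_r) (L : set 'cV[int]_r) :=
  forall m, L m -> laurent_monom P m = 1.

Lemma annihilates_lattice_ideal (P : 'rV[K]_r) (L : set 'cV[int]_r) :
  torus K r P -> annihilates P L ->
  forall F, lattice_ideal K L F -> F.@[P 0] = 0.
Proof.
move=> tP PL; apply: ideal_gen_zero => F [a [b [/PL + ->]]].
rewrite laurent_monomB// mevalB !meval_laurent => e.
rewrite -[X in X - _](mulfVK (laurent_monom_neq0 (expvec b) tP)).
by rewrite e mul1r subrr.
Qed.

(** Only homogeneous elements are tested, and [L] inside [int_ker beta] makes the binomials built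
    from [pos_part] homogeneous. *)
Lemma lattice_ideal_annihilates (d : nat) (beta : 'M[int]_(d, r))
    (P : 'rV[K]_r) (L : set 'cV[int]_r) :
  L `<=` int_ker beta -> torus K r P ->
  (forall F, lattice_ideal K L F -> homogeneous beta F -> F.@[P 0] = 0) ->
  annihilates P L.
Proof.
move=> Lb tP LP m Lm.
rewrite -(pos_partB m) laurent_monomB// -!meval_laurent.
have -> : 'X_[pos_part m].@[P 0] = 'X_[pos_part (- m)].@[P 0] :> K.
  apply/eqP; rewrite -subr_eq0 -mevalB; apply/eqP/LP.
    apply: sub_ideal_gen; exists (pos_part m), (pos_part (- m)).
    by rewrite pos_partB.
  by apply: homogeneous_binomial; rewrite pos_partB; apply: Lb.
by rewrite divff// meval_laurent laurent_monom_neq0.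
Qed.

End Ideals.

(** * Discrete logarithms and linear systems modulo an integer *)

Lemma expf_card_pred (K : finFieldType) (x : K) :
  x != 0 -> x ^ (#|K|%:Z - 1) = 1.
Proof.
by move=> x0; rewrite expfzDr// exprN1 -exprnP expf_card divff.
Qed.

Lemma finField_generator (K : finFieldType) :
  exists eta : K, [/\ eta != 0,
    forall x, x != 0 -> exists k : int, x = eta ^ k &
    forall k : int, eta ^ k = 1 -> (#|K|%:Z - 1 %| k)%Z].
Proof.
have /cyclicP[u uT] := field_unit_group_cyclic [set: {unit K}]%G.
have u0 : val u != 0 by rewrite -unitfE; apply: (valP u).
exists (val u); split => // [x x0|k].
  have xU : x \is a GRing.unit by rewrite unitfE.
  have : FinRing.unit K xU \in <[u]>%g by rewrite -uT inE.
  by case/cycleP => i /(congr1 val); rewrite FinRing.val_unitX => e; exists i.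
have -> : #|K|%:Z - 1 = #[u]%g.
  rewrite orderE -uT card_finField_unit.
  by move: #|K| (finNzRing_gt1 K) => q; lia.
rewrite dvdzE absz_nat => uk; rewrite order_dvdn; apply/eqP/val_inj.
rewrite FinRing.val_unitX /= exprnP.
case: k uk => k; first by [].
by rewrite NegzE -exprnN => /eqP; rewrite invr_eq1 => /eqP.
Qed.

(** In Smith coordinates the system splits into one congruence per column: the first hypothesis
    settles a zero divisor, while saturation makes a nonzero one coprime to [N], so that Bezout
    applies. *)
Lemma solve_linear_mod (N : int) (s n : nat) (W : 'M[int]_(s, n))
    (c : 'rV[int]_n) :
  (forall m : 'cV[int]_n, W *m m = 0 -> (N %| (c *m m) 0%R 0%R)%Z) ->
  (forall (z : 'cV[int]_s) (m : 'cV[int]_n), N *: z = W *m m ->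
     exists m', z = W *m m') ->
  exists (tau : 'rV[int]_s) (e : 'rV[int]_n), tau *m W = c + N *: e.
Proof.
case: (int_Smith_normal_form W) => L uL [M uM [d _ WE]] cker sat.
set D := (\matrix_(i, j) _) in WE.
(* The elementary divisor of column [j], taken as 0 for columns beyond the number of rows, where
   [E j] vanishes too. *)
pose f (j : 'I_n) : int := if (j < s)%N then d`_j else 0.
pose E (j : 'I_n) : 'cV[int]_s := \col_i (i == j :> nat)%:R.
have colD j : col j D = f j *: E j.
  apply/colP => i; rewrite !mxE /f; have [ij|_] := eqVneq (i : nat) j.
    by rewrite -ij ltn_ord mulr1.
  by rewrite mulr0.
pose v j := invmx M *m delta_mx j (0 : 'I_1).
have Wv j : W *m v j = f j *: (L *m E j).
  by rewrite WE /v mulmxA mulmxK// -mulmxA -colE colD scalemxAr.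
have cv j : (c *m v j) 0 0 = (c *m invmx M) 0 j.
  by rewrite /v mulmxA -colE mxE.
have step j : exists x : int, exists e : int,
    x * f j = (c *m invmx M) 0 j + N * e.
  have [fj|fj] := eqVneq (f j) 0.
    have /dvdzP[e ee] : (N %| (c *m v j) 0%R 0%R)%Z.
      by rewrite cker// Wv fj scale0r.
    by exists 0, (- e); rewrite -cv ee; ring.
  have js : (j < s)%N by move: fj; rewrite /f; case: ifP => //; rewrite eqxx.
  have [a fa] : exists a, f j = a * gcdz (f j) N by apply/dvdzP/dvdz_gcdl.
  have [b Nb] : exists b, N = b * gcdz (f j) N by apply/dvdzP/dvdz_gcdr.
  (* With [g] the gcd, [f j = a * g] and [N = b * g] give [N * a = b * f j], so saturation puts
     [a *: (L *m E j)] in the image of [W]. Its coordinate [j] shows that [f j] divides [a], hence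
     that [g] divides 1. *)
  have [|m' /(congr1 (mulmx (invmx L)))] := sat (a *: (L *m E j)) (b *: v j).
    rewrite -scalemxAr Wv !scalerA [in LHS]Nb [in RHS]fa.
    by congr (_ *: _); ring.
  rewrite WE -!mulmxA mulKmx// -scalemxAr mulKmx// => /colP/(_ (Ordinal js)).
  rewrite !(mxE _ _ (Ordinal js)) eqxx mulr1 (bigD1 j)//= big1 ?addr0;
    last first.
    by move=> i ij; rewrite mxE eq_sym -[_ == _]/(i == j) (negPf ij) mul0r.
  rewrite mxE eqxx => aE.
  have [a0|a0] := eqVneq a 0; first by rewrite fa a0 mul0r eqxx in fj.
  have g1 : gcdz (f j) N = 1.
    have : (gcdz (f j) N %| 1)%Z.
      apply/dvdzP; exists ((M *m m') j 0); apply: (mulfI a0).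
      by rewrite [RHS]mulrCA -fa mulr1 [LHS]aE /f js mulrC.
    by rewrite dvdz1 => /eqP /(congr1 Posz).
  have [u [w uw]] := Bezoutz (f j) N.
  exists (u * (c *m invmx M) 0 j), (- ((c *m invmx M) 0 j * w)).
  by rewrite g1 in uw; rewrite -[X in _ = X + _]mulr1 -uw; ring.
have /choice[x xP] := step.
have /choice[e eP] := xP.
(* The row [x] brought to length [s]: padding is by zeros, and an [x j] with [j >= s] may be dropped
   because [f j = 0]. *)
pose tau : 'rV[int]_s := \row_i \sum_j x j *+ (i == j :> nat).
exists (tau *m invmx L), ((\row_j e j) *m M).
rewrite {1}WE -!mulmxA mulKmx// mulmxA scalemxAl.
rewrite -[X in X + _](mulmxKV uM) -mulmxDl; congr (_ *m _).
apply/rowP => j; transitivity (x j * f j); last first.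
  by rewrite eP [RHS]mxE [X in _ = _ + X]mxE [X in _ = _ + _ * X]mxE.
rewrite mxE /f; case: ifP => js.
  rewrite (bigD1 (Ordinal js))//= big1 ?addr0; last first.
    move=> i /negPf ij; rewrite [D _ _]mxE.
    by rewrite (ij : (i == j :> nat) = false) mulr0.
  rewrite !mxE eqxx (bigD1 j)//= big1 ?addr0 ?eqxx// => k /negPf kj.
  by rewrite eq_sym (kj : (k == j :> nat) = false).
rewrite mulr0; apply: big1 => i _; rewrite [D _ _]mxE.
case: eqP => [ij|]; last by rewrite mulr0.
by rewrite -ij ltn_ord in js.
Qed.

(** * Orbits of the Cox group *)

Section CoxPoints.

Variables (K : fieldType) (n r : nat) (phi : 'M[int]_(r, n)).

Lemma Cox_groupP (g : 'rV[K]_r) :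
  Cox_group K phi g <->
  torus K r g /\ forall m : 'cV[int]_n, laurent_monom g (phi *m m) = 1.
Proof.
split=> -[gT g1]; split=> //; last first.
  by apply/rowP => j; rewrite !mxE colE g1.
by move=> m; rewrite -laurent_monom_map// g1 laurent_monom1.
Qed.

Lemma Cox_point_refl (P : 'rV[K]_r) : Cox_point phi P P.
Proof.
exists (const_mx 1); last by apply/rowP => i; rewrite !mxE mul1r.
apply/Cox_groupP; split=> [i|m]; first by rewrite mxE oner_neq0.
by rewrite laurent_monom1.
Qed.

Lemma Cox_point_act (g P : 'rV[K]_r) :
  Cox_group K phi g -> Cox_point phi (\row_i (g 0 i * P 0 i)) = Cox_point phi P.
Proof.
move=> /Cox_groupP[gT g1]; apply/seteqP; split=> _ [h /Cox_groupP[hT h1] <-].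
  exists (\row_i (h 0 i * g 0 i)).
    apply/Cox_groupP; split=> [i|m]; first by rewrite mxE mulf_neq0.
    by rewrite laurent_monomM g1 h1 mulr1.
  by apply/rowP => i; rewrite !mxE mulrA.
exists (\row_i (h 0 i * (\row_i (g 0 i)^-1) 0 i)).
  apply/Cox_groupP; split=> [i|m]; first by rewrite !mxE mulf_neq0 ?invr_eq0.
  rewrite laurent_monomM h1 mul1r -[LHS]mul1r -[X in X * _](g1 m).
  rewrite -laurent_monomM -[RHS](laurent_monom1 K (phi *m m)).
  by congr laurent_monom; apply/rowP => i; rewrite !mxE divff.
by apply/rowP => i; rewrite !mxE mulrA mulfVK.
Qed.

Lemma Cox_point_inj (P P' : 'rV[K]_r) :
  Cox_point phi P = Cox_point phi P' ->
  exists2 g, Cox_group K phi g & P = \row_i (g 0 i * P' 0 i).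
Proof.
by move=> e; have := Cox_point_refl P; rewrite e => -[g gG <-]; exists g.
Qed.

Lemma Cox_point_torus (P P' : 'rV[K]_r) :
  Cox_point phi P = Cox_point phi P' -> torus K r P' -> torus K r P.
Proof.
by move=> /Cox_point_inj[g [gT _] ->] P'T i; rewrite mxE mulf_neq0.
Qed.

(** Elements of the Cox group are trivial on the image of [phi], so annihilating a lattice inside
    this image is a property of the orbit. *)
Lemma Cox_point_annihilates (L : set 'cV[int]_r) (P P' : 'rV[K]_r) :
  (forall x, L x -> exists m, x = phi *m m) ->
  Cox_point phi P = Cox_point phi P' -> annihilates P' L -> annihilates P L.
Proof.
move=> Lphi /Cox_point_inj[g /Cox_groupP[_ g1] ->] P'L m Lm.
by rewrite laurent_monomM P'L// mulr1; have [m' ->] := Lphi _ Lm.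
Qed.

(** Completeness provides a cone, and its monomial in the irrelevant ideal is nonzero at every torus
    point. *)
Lemma irrelevant_torus (R : realType) (Sigma : set (set 'rV[R]_n))
    (P : 'rV[K]_r) :
  complete_fan Sigma -> torus K r P ->
  ~ affine_zeros (irrelevant_ideal K Sigma phi) P.
Proof.
move=> cS PT; have [sigma Ss _] := cS 0.
pose F : {mpoly K[r]} := \prod_(i < r | `[< ~ (ray R phi i `<=` sigma) >]) 'X_i.
have PF : F.@[P 0] != 0.
  rewrite rmorph_prod /=; apply/prodf_neq0 => i _; rewrite mevalXU; apply: PT.
move=> /(_ F) F0; move/eqP: PF; apply; apply: F0.
by apply: sub_ideal_gen; exists sigma.
Qed.

End CoxPoints.

(** * Zeros of a lattice ideal lie in the torus *)

Lemma clear_denominators (n : nat) (w : 'I_n -> rat) :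
  exists N : int, 0 < N /\ exists m : 'I_n -> int,
    forall j, (m j)%:~R = N%:~R * w j.
Proof.
exists (\prod_j denq (w j)); split; first by apply: prodr_gt0.
exists (fun j => numq (w j) * \prod_(k | k != j) denq (w k)) => j.
rewrite [in RHS](bigD1 j)//= !intrM.
rewrite -[X in _ = _ * X](divq_num_den (w j)) mulrCA.
by congr (_ * _); rewrite mulrAC divff ?mul1r// intr_eq0 denq_neq0.
Qed.

(* Linear independence of the rays in [sigma] makes the all-ones vector on [J]
   a combination of the columns of [phi] restricted to [J]. *)
Lemma simplicial_positive (R : realType) (n r : nat)
    (Sigma : set (set 'rV[R]_n)) (phi : 'M[int]_(r, n)) (sigma : set 'rV[R]_n)
    (J : pred 'I_r) :
  simplicial_fan Sigma phi -> Sigma sigma ->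
  (forall i, J i -> ray R phi i `<=` sigma) ->
  exists m : 'cV[int]_n, forall i, J i -> 0 < (phi *m m) i 0.
Proof.
move=> sS Ss Jsigma.
pose M : 'M[rat]_(r, n) := \matrix_(i, j) ((phi i j)%:~R *+ J i).
pose v : 'rV[rat]_r := \row_i (J i)%:R.
have : (v <= M^T)%MS.
  rewrite submxE; apply/eqP/rowP => k; rewrite mxE [RHS]mxE.
  (* A column of [C], restricted to [J], is a linear relation among rays of [sigma], hence zero by
     simpliciality. *)
  set C := cokermx _.
  have c0 := sS _ Ss (fun i => ratr (C i k *+ J i)).
  apply: big1 => i _; rewrite mxE; apply/eqP.
  rewrite mulr_natl -(fmorph_eq0 (@ratr R)); apply/eqP/c0.
    move=> {}i Ni; case Ji: (J i); last by rewrite mulr0n rmorph0.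
    by case: Ni; apply: Jsigma.
  apply/rowP => j; rewrite summxE [RHS]mxE.
  have /matrixP/(_ j k) := mulmx_coker M^T; rewrite mxE [RHS]mxE => e.
  transitivity (ratr (\sum_i M^T j i * C i k) : R); last by rewrite e rmorph0.
  rewrite rmorph_sum; apply: eq_bigr => {}i _ /=; rewrite !mxE rmorphM /= mulrC.
  by case: (J i); rewrite ?mulr1n ?ratr_int// !mulr0n rmorph0 mulr0 mul0r.
move=> /submxP[w wE].
have [N [N0 [m mE]]] := clear_denominators (w 0).
exists (\col_j m j) => i Ji.
rewrite -(ltr0z rat) (_ : (_)%:~R = N%:~R :> rat) ?ltr0z//.
rewrite mxE rmorph_sum /=.
move/rowP/(_ i): wE; rewrite !mxE Ji => e.
rewrite -[RHS]mulr1 -[X in _ * X]/(true%:R) e mulr_sumr.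
apply: eq_bigr => j _; rewrite !mxE Ji mulr1n intrM mE.
by rewrite mulrCA [w 0 j * _]mulrC.
Qed.

Lemma zero_locus_torus (R : realType) (K : fieldType) (n r d : nat)
    (Sigma : set (set 'rV[R]_n)) (phi : 'M[int]_(r, n)) (beta : 'M[int]_(d, r))
    (L : set 'cV[int]_r) (N : int) (P : 'rV[K]_r) :
  simplicial_fan Sigma phi -> (forall m : 'cV[int]_n, beta *m (phi *m m) = 0) ->
  0 < N -> lattice_scale N (int_ker beta) `<=` L ->
  ~ affine_zeros (irrelevant_ideal K Sigma phi) P ->
  (forall F, lattice_ideal K L F -> homogeneous beta F -> F.@[P 0] = 0) ->
  torus K r P.
Proof.
move=> sS bphi N0 NL BP LP.
(* If no cone contained all rays at which [P] vanishes, every generator of the irrelevant ideal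
   would vanish at [P]. *)
have [sigma Ss Psigma] : exists2 sigma, Sigma sigma &
    forall i, P 0 i = 0 -> ray R phi i `<=` sigma.
  apply: contrapT => nsigma; apply: BP.
  apply: ideal_gen_zero => _ [sigma Ss <-].
  apply: contrapT => /eqP; rewrite rmorph_prod => /prodf_neq0 Pi.
  apply: nsigma; exists sigma => // i Pi0.
  apply: contrapT => /asboolT ni.
  by have := Pi i ni; rewrite /= mevalXU Pi0 eqxx.
have [m mP] := @simplicial_positive _ _ _ _ _ _ (fun i => P 0 i == 0) sS Ss
  (fun i Pi0 => Psigma i (eqP Pi0)).
move=> j; apply/negP => Pj0.
(* This vector of [L] is positive wherever [P] vanishes: [P 0 j = 0] kills the monomial of its
   positive part, while the negative part involves only nonzero coordinates. *)
pose x := N *: (phi *m m).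
have bx : beta *m x = 0 by rewrite -scalemxAr bphi scaler0.
have xpos i : P 0 i == 0 -> 0 < x i 0.
  by move=> /mP mi; rewrite mxE mulr_gt0.
have : ('X_[pos_part x] - 'X_[pos_part (- x)]).@[P 0] = 0.
  apply: LP; last by apply: homogeneous_binomial; rewrite pos_partB.
  apply: sub_ideal_gen; exists (pos_part x), (pos_part (- x)).
  rewrite pos_partB; split=> //; apply: NL.
  by exists (phi *m m) => //; apply: bphi.
rewrite mevalB !mevalX => /eqP; rewrite subr_eq0 => /eqP.
rewrite (bigD1 j)//= (eqP Pj0) mnmE ltW ?xpos// expr0n.
rewrite absz_eq0 gt_eqF ?xpos// mul0r => /esym/eqP; apply/negP.
apply/prodf_neq0 => i _; rewrite expf_eq0 negb_and -leqNgt orbC.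
have [/xpos xi|//] := boolP (P 0 i == 0).
by rewrite mnmE mxE oppr_ge0 leNgt xi.
Qed.

(** * Characters of the finite torus *)

Section Characters.

Variables (K : finFieldType) (s : nat).

(** Indexes the torus points by a finite type, so that one can sum over them. *)
Definition unit_row (u : {ffun 'I_s -> {unit K}}) : 'rV[K]_s :=
  \row_i val (u i).

Lemma unit_row_torus u : torus K s (unit_row u).
Proof. by move=> i; rewrite mxE -unitfE; apply: (valP (u i)). Qed.

Lemma torus_unit_row (t : 'rV[K]_s) : torus K s t -> exists u, t = unit_row u.
Proof.
move=> tT; have tU i : t 0 i \is a GRing.unit by rewrite unitfE; apply: tT.
by exists [ffun i => FinRing.unit K (tU i)]; apply/rowP => i; rewrite mxE ffunE.
Qed.

(** Translation by 1 permutes [K], so adding [#|K|] to the sum of all elements does not change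
    it. *)
Lemma card_finField_natr : #|K|%:R = 0 :> K.
Proof.
have : \sum_(x : K) (x + 1) = \sum_x x.
  by rewrite [RHS](reindex_inj (addIr 1)).
rewrite big_split /= sumr_const => /eqP.
by rewrite -subr_eq0 addrAC subrr add0r => /eqP.
Qed.

(** The torus has [(#|K| - 1) ^ s] points, and [#|K| - 1] equals -1 in [K]. *)
Lemma card_units_natr : #|{ffun 'I_s -> {unit K}}|%:R != 0 :> K.
Proof.
rewrite card_ffun natrX expf_neq0// -cardsT card_finField_unit.
have := card_finField_natr; rewrite -(ltn_predK (finNzRing_gt1 K)) -natr1.
by move=> /eqP; rewrite addr_eq0 => /eqP ->; rewrite oppr_eq0 oner_neq0.
Qed.

(** Translating by [u0] permutes the torus and multiplies the sum by a scalar other than 1. *)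
Lemma sum_character (a : 'cV[int]_s) u0 :
  laurent_monom (unit_row u0) a != 1 ->
  \sum_u laurent_monom (unit_row u) a = 0.
Proof.
move=> u01; pose h (u : {ffun 'I_s -> {unit K}}) := [ffun i => (u0 i * u i)%g].
have hI : injective h.
  move=> u v /ffunP uv; apply/ffunP => i.
  by have := uv i; rewrite !ffunE => /mulgI.
have : \sum_u laurent_monom (unit_row (h u)) a =
    laurent_monom (unit_row u0) a * \sum_u laurent_monom (unit_row u) a.
  rewrite mulr_sumr; apply: eq_bigr => u _; rewrite -laurent_monomM.
  by congr laurent_monom; apply/rowP => i; rewrite !mxE ffunE.
rewrite -(reindex_inj hI (P := xpredT)
  (F := fun u => laurent_monom (unit_row u) a)) /=.
set S := \sum_u _ => /eqP; rewrite -subr_eq0 -{1}[S]mul1r -mulrBl.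
by rewrite mulf_eq0 subr_eq0 eq_sym (negPf u01) => /eqP.
Qed.

(** The point with a generator of the units at place [i] and 1 elsewhere tests the divisibility of
    [a i 0]. *)
Lemma trivial_character (a : 'cV[int]_s) :
  (forall u, laurent_monom (unit_row u) a = 1) ->
  exists z, a = (#|K|%:Z - 1) *: z.
Proof.
move=> a1; have [eta [eta0 _ etaN]] := finField_generator K.
have /choice[z zE] i : exists z : int, a i 0 = (#|K|%:Z - 1) * z.
  have [|u uE] := torus_unit_row (t := \row_j if j == i then eta else 1).
    by move=> j; rewrite mxE; case: ifP => // _; apply: oner_neq0.
  have := a1 u; rewrite -uE /laurent_monom (bigD1 i)//= big1 => [|j /negPf ji].
    by rewrite mulr1 mxE eqxx => /etaN/dvdzP[z ->]; exists z; rewrite mulrC.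
  by rewrite mxE ji exp1rz.
by exists (\col_i z i); apply/colP => i; rewrite !mxE.
Qed.

(* Orthogonality of characters isolates the coefficients of the monomials that
   restrict to a given character of the torus. *)
Lemma vanishing_fiber_sum (r : nat) (Q : 'M[int]_(s, r)) (F : {mpoly K[r]})
    (m0 : 'X_{1..r}) :
  (forall t, torus K s t -> F.@[monom_map Q t 0] = 0) ->
  \sum_(m <- msupp F |
      [forall u, laurent_monom (unit_row u) (Q *m (expvec m - expvec m0)) == 1])
    F@_m = 0.
Proof.
move=> F0.
have : \sum_u F.@[monom_map Q (unit_row u) 0] /
    laurent_monom (unit_row u) (Q *m expvec m0) = 0.
  by apply: big1 => u _; rewrite F0 ?mul0r//; apply: unit_row_torus.
have -> : \sum_u F.@[monom_map Q (unit_row u) 0] /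
    laurent_monom (unit_row u) (Q *m expvec m0) =
  \sum_(m <- msupp F) F@_m *
    \sum_u laurent_monom (unit_row u) (Q *m (expvec m - expvec m0)).
  under [RHS]eq_bigr do rewrite mulr_sumr.
  rewrite exchange_big /=; apply: eq_bigr => u _; have uT := unit_row_torus u.
  rewrite {1}[F]mpolyE raddf_sum mulr_suml /=; apply: eq_bigr => m _.
  rewrite mevalZ meval_laurent laurent_monom_map//.
  by rewrite mulmxBr laurent_monomB// mulrA.
(* Nontrivial characters sum to 0, trivial ones to the number of torus points, which is invertible
   in [K]. *)
rewrite (bigID (fun m => [forall u,
  laurent_monom (unit_row u) (Q *m (expvec m - expvec m0)) == 1])) /=.
rewrite [X in _ + X]big1 ?addr0 => [|m /forallPn[u u1]]; last first.
  by rewrite (sum_character u1) mulr0.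
under eq_bigr => m /forallP m1.
  under eq_bigr => u _ do rewrite (eqP (m1 u)).
  rewrite sumr_const; over.
rewrite -mulr_suml => /eqP; rewrite mulf_eq0 => /orP[/eqP//|].
by move=> /(negP card_units_natr).
Qed.

End Characters.

(** Moving each monomial to a representative of its fibre changes [F] by an element of the ideal;
    what remains has the fibre sums as coefficients, all zero. *)
Lemma lattice_ideal_fibers (K : fieldType) (r : nat) (T : eqType)
    (key : 'X_{1..r} -> T) (L : set 'cV[int]_r) (F : {mpoly K[r]}) :
  (forall m m', key m = key m' -> L (expvec m - expvec m')) ->
  (forall m0, \sum_(m <- msupp F | key m == key m0) F@_m = 0) ->
  lattice_ideal K L F.
Proof.
move=> keyL F0.
(* The result of [choose] does not depend on its starting point, so equal keys give the same
   representative. *)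
pose rep m := choose (fun m' => key m' == key m) m.
have key_rep m : key (rep m) = key m.
  by apply/eqP; apply: (@chooseP _ (fun m' => key m' == key m)); apply: eqxx.
have rep_key m m' : key m = key m' -> rep m = rep m'.
  by move=> mm'; rewrite /rep mm'; apply: choose_id; rewrite ?mm' eqxx.
have FE : F = \sum_(m <- msupp F) (F@_m)%:MP * ('X_[m] - 'X_[rep m]).
  under eq_bigr => m _ do rewrite mulrBr !mul_mpolyC.
  rewrite sumrB -mpolyE -[LHS]subr0; congr (_ - _).
  apply/esym/mpolyP => k; rewrite mcoeff0 raddf_sum /=.
  have [[m0 mk]|Nk] := pselect (exists m0, rep m0 = k).
    rewrite -[RHS](F0 m0) [RHS]big_mkcond; apply: eq_bigr => m _ /=.
    rewrite mcoeffZ mcoeffX -mk; case: eqP => [/(congr1 key)|ne].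
      by rewrite !key_rep => ->; rewrite eqxx mulr1.
    by case: eqP => [/rep_key|_]; rewrite ?mulr0.
  apply: big1 => m _; rewrite mcoeffZ mcoeffX.
  by case: eqP => [mk|_]; [case: Nk; exists m | rewrite mulr0].
rewrite FE; apply: ideal_gen_sum => m _; exists m, (rep m); split=> //.
by apply: keyL; rewrite key_rep.
Qed.

(** * Homogeneous matrices and the points they parameterize *)

Lemma homogeneous_matrix_ker (r d s : nat) (beta : 'M[int]_(d, r))
    (Q : 'M[int]_(s, r)) :
  homogeneous_matrix beta Q -> int_ker Q `<=` int_ker beta.
Proof.
move=> [A AQ] m Qm.
have e : map_mx intr (beta *m m) = 0 :> 'cV[rat]_d.
  by rewrite map_mxM -AQ -mulmxA -map_mxM Qm map_mx0 mulmx0.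
apply/colP => i; apply/eqP; rewrite [X in _ == X]mxE -(intr_eq0 rat).
by move/colP/(_ i): e; rewrite mxE => ->; rewrite mxE.
Qed.

(* In discrete logarithms, a torus point killed by the characters in [int_ker Q]
   is a homomorphism from [im (Q *m phi)] to Z/(q-1); saturation of this image
   lets it extend to all of Z^s. *)
Lemma annihilates_parameterized (K : finFieldType) (n r s : nat)
    (phi : 'M[int]_(r, n)) (Q : 'M[int]_(s, r)) (P : 'rV[K]_r) :
  (forall (z : 'cV[int]_s) (m : 'cV[int]_n),
     (#|K|%:Z - 1) *: z = Q *m phi *m m -> exists m', z = Q *m phi *m m') ->
  torus K r P -> annihilates P (int_ker Q) ->
  exists2 t, torus K s t & Cox_point phi (monom_map Q t) = Cox_point phi P.
Proof.
move=> sat PT PQ; have [eta [eta0 etaP etaN]] := finField_generator K.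
have /choice[p pP] i : exists k : int, P 0 i = eta ^ k by apply: etaP.
have powE k (e : 'I_k -> int) (t : 'rV[K]_k) (m : 'cV[int]_k) :
    (forall i, t 0 i = eta ^ e i) ->
    laurent_monom t m = eta ^ ((\row_i e i) *m m) 0 0.
  move=> te; rewrite mxE expfz_sum//; apply: eq_bigr => i _.
  by rewrite te mxE exprz_exp.
(* The unknown [tau] holds the logarithms of a parameter whose image agrees with [P] on all
   characters [phi *m m]. *)
have [m Wm||tau [e tauE]] :=
    @solve_linear_mod (#|K|%:Z - 1) _ _ (Q *m phi) ((\row_i p i) *m phi).
- apply: etaN; rewrite -mulmxA -(powE _ _ _ _ pP); apply: PQ.
  by rewrite /int_ker /= mulmxA.
- exact: sat.
pose t : 'rV[K]_s := \row_i eta ^ tau 0 i.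
have tT : torus K s t by move=> i; rewrite mxE expfz_neq0.
exists t => //.
(* The ratio of the two points; agreement on the image of [phi] places it in the Cox group. *)
pose g : 'rV[K]_r := \row_i (monom_map Q t 0 i / P 0 i).
have gT : torus K r g.
  by move=> i; rewrite mxE mulf_neq0 ?invr_eq0// monom_map_torus.
have gP : \row_i (g 0 i * P 0 i) = monom_map Q t.
  by apply/rowP => i; rewrite !mxE divfK.
rewrite -gP; apply: Cox_point_act; apply/Cox_groupP; split=> // m.
apply: (mulIf (laurent_monom_neq0 (phi *m m) PT)); rewrite mul1r.
rewrite -laurent_monomM gP laurent_monom_map// (powE _ _ _ _ pP).
rewrite (powE _ (tau 0)) => [|i]; last by rewrite mxE.
have -> : \row_i tau 0 i = tau by apply/rowP => i; rewrite mxE.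
rewrite !mulmxA -[tau *m Q *m phi]mulmxA tauE mulmxDl -scalemxAl.
rewrite mxE expfzDr// [X in _ * eta ^ X]mxE -exprz_exp.
by rewrite expf_card_pred// exp1rz mulr1.
Qed.

(** * Comparison of the zero loci, the toric set and the vanishing ideal *)

Theorem theorem3p10 (R : realType) (K : finFieldType) (n r d s : nat)
    (Sigma : set (set 'rV[R]_n)) (phi : 'M[int]_(r, n)) (beta : 'M[int]_(d, r))
    (Q : 'M[int]_(s, r))
    (hfan : is_fan Sigma)
    (hrays : ray_generators Sigma phi)
    (hcomplete : complete_fan Sigma)
    (hsimplicial : simplicial_fan Sigma phi)
    (hexact : short_exact phi beta)
    (hQ : homogeneous_matrix beta Q) :
  let q1 : int := #|K|%:Z - 1 in
  let LQ : set 'cV[int]_r := int_ker Q in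
  let Lbeta : set 'cV[int]_r := int_ker beta in
  let L : set 'cV[int]_r := lattice_add LQ (lattice_scale q1 Lbeta) in
  let calL : set 'cV[int]_s := [set Q *m m | m in Lbeta] in
  let YQ : set (set 'rV[K]_r) := toric_set K phi Q in
  let VQ : set (set 'rV[K]_r) :=
    zero_locus Sigma phi beta (lattice_ideal K LQ) `&` torus_X K phi in
  let VL : set (set 'rV[K]_r) := zero_locus Sigma phi beta (lattice_ideal K L) in
  [/\ VQ = VL,
      calL = lattice_colon calL q1 -> VQ = YQ &
      calL = lattice_colon calL q1 ->
        vanishing_ideal phi beta VL = lattice_ideal K L].
Proof.
move=> q1 LQ Lbeta L calL YQ VQ VL.
have [_ exact_mid _] := hexact.
have q1_gt0 : 0 < q1 by rewrite subr_gt0 ltz_nat finNzRing_gt1.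
have LQ_beta : LQ `<=` Lbeta := homogeneous_matrix_ker hQ.
have beta_phi (m : 'cV[int]_n) : beta *m (phi *m m) = 0.
  by apply/exact_mid; exists m.
have L_beta : L `<=` Lbeta.
  move=> _ [m1 [_ [/LQ_beta m1b [m2 m2b <-] ->]]].
  by rewrite /Lbeta /int_ker /= mulmxDr m1b -scalemxAr m2b scaler0 addr0.
have LQ_L : LQ `<=` L.
  move=> m mQ; exists m, 0; split; rewrite ?addr0//.
  by exists 0; [exact: mulmx0 | rewrite scaler0].
have NL : lattice_scale q1 Lbeta `<=` L.
  by move=> m mb; exists 0, m; split; rewrite ?add0r//; apply: mulmx0.
have annL P : torus K r P -> annihilates P LQ -> annihilates P L.
  move=> PT PQ _ [m1 [_ [m1Q [m2 _ <-] ->]]].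
  rewrite laurent_monomD// PQ// laurent_monomZ mul1r.
  by rewrite expf_card_pred ?laurent_monom_neq0.
(* Here [torus_X] puts the points in the torus; for [VL] below, [zero_locus_torus] does. *)
have VQE : VQ = [set Cox_point phi P | P in
    [set P | torus K r P /\ annihilates P LQ]].
  apply/seteqP; split=> [_ [[P [_ PQ] <-] [P' P'T e]]|_ [P [PT PQ] <-]].
    have PT := Cox_point_torus (esym e) P'T.
    by exists P => //; split=> //; apply: lattice_ideal_annihilates PQ.
  split; last by exists P.
  exists P => //; split; first exact: irrelevant_torus.
  by move=> F FQ _; apply: annihilates_lattice_ideal FQ.
have VLE : VL = [set Cox_point phi P | P in
    [set P | torus K r P /\ annihilates P L]].
  apply/seteqP; split=> [_ [P [BP PL] <-]|_ [P [PT PL] <-]].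
    have PT := zero_locus_torus hsimplicial beta_phi q1_gt0 NL BP PL.
    by exists P => //; split=> //; apply: lattice_ideal_annihilates PL.
  exists P => //; split; first exact: irrelevant_torus.
  by move=> F FL _; apply: annihilates_lattice_ideal FL.
have VQ_VL : VQ = VL.
  rewrite VQE VLE; apply/seteqP; split=> _ [P [PT PL] <-]; exists P => //.
    by split=> //; apply: annL.
  by split=> // m /LQ_L /PL.
have VQ_YQ : calL = lattice_colon calL q1 -> VQ = YQ.
  move=> calLE; rewrite VQE; apply/seteqP.
  split=> [_ [P [PT PQ] <-]|_ [t tT <-]].
    have [z m zm|t tT tE] :=
        annihilates_parameterized (phi := phi) _ PT PQ; last by exists t.
    (* Since [phi *m m] has degree 0, [q1 *: z] lies in [calL]; the hypothesis then puts [z] itself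
       in [calL]. *)
    have : lattice_colon calL q1 z.
      by exists (phi *m m); rewrite ?mulmxA//; apply: beta_phi.
    by rewrite -calLE => -[_ /exact_mid[m' ->] <-]; exists m'; rewrite mulmxA.
  exists (monom_map Q t) => //; split; first exact: monom_map_torus.
  by move=> m mQ; rewrite laurent_monom_map// mQ laurent_monom0.
split=> // calLE; apply/seteqP; split; last first.
  apply: ideal_gen_mono => _ [a [b [ab ->]]]; split.
    by apply: homogeneous_binomial; apply: L_beta.
  move=> P; rewrite VLE => -[P' [P'T P'L] e].
  have PT := Cox_point_torus (esym e) P'T.
  apply: (annihilates_lattice_ideal (L := L)) => //.
    apply: Cox_point_annihilates (esym e) P'L => m /L_beta.
    by move=> /exact_mid.
  by apply: sub_ideal_gen; exists a, b.
apply: ideal_gen_sub => F [[delta Fdelta] F0].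
have Ft t : torus K s t -> F.@[monom_map Q t 0] = 0.
  by move=> tT; apply: F0; rewrite -VQ_VL VQ_YQ//; exists t.
(* A fibre of [key] collects the monomials of one degree that pull back to the same function of the
   parameter [t]. *)
pose key (m : 'X_{1..r}) := (beta *m expvec m,
  [ffun u => laurent_monom (@unit_row K s u) (Q *m expvec m)]).
apply: (lattice_ideal_fibers (key := key)) => [m m'|m0].
  move=> [bm /ffunP Qm].
  have bmm : Lbeta (expvec m - expvec m').
    by rewrite /Lbeta /int_ker /= mulmxBr bm subrr.
  have [u|z zE] := @trivial_character K s (Q *m (expvec m - expvec m')).
    have := Qm u; rewrite !ffunE mulmxBr laurent_monomB => [->|].
      by rewrite divff// laurent_monom_neq0//; apply: unit_row_torus.
    exact: unit_row_torus.
  (* Saturation gives [z = Q *m w] with [w] of degree 0; subtracting [q1 *: w] from the difference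
     of exponents leaves an element of [LQ]. *)
  have : lattice_colon calL q1 z by exists (expvec m - expvec m').
  rewrite -calLE => -[w wb wz].
  exists (expvec m - expvec m' - q1 *: w), (q1 *: w); split.
  - by rewrite /LQ /int_ker /= mulmxBr zE -scalemxAr wz subrr.
  - by exists w.
  - by rewrite subrK.
(* Fibres of degree other than [delta] contain no monomial of [F]; in degree [delta] the sum is that
   of [vanishing_fiber_sum]. *)
have [m0d|m0d] := eqVneq (beta *m expvec m0) delta; last first.
  rewrite big_seq_cond big1// => m /andP[mF].
  by rewrite xpair_eqE => /andP[/eqP e]; rewrite -e (Fdelta _ mF) eqxx in m0d.
rewrite -[RHS](vanishing_fiber_sum m0 Ft) big_seq_cond [RHS]big_seq_cond.
apply: eq_bigl => m; case mF: (m \in msupp F) => //=.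
rewrite xpair_eqE (Fdelta _ mF) m0d eqxx /=.
apply/eqP/forallP => [/ffunP e u|e].
  have uT := @unit_row_torus K s u.
  have := e u; rewrite !ffunE mulmxBr laurent_monomB// => ->.
  by rewrite divff// laurent_monom_neq0.
apply/ffunP => u; have uT := @unit_row_torus K s u; rewrite !ffunE.
have := e u; rewrite mulmxBr laurent_monomB// => /eqP e1.
apply: (divIf (laurent_monom_neq0 (Q *m expvec m0) uT)).
by rewrite e1 divff// laurent_monom_neq0.
Qed.
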